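(* The general versions of the rules R$\Box$ and L$\Diamond$, $$\mathrm{R}\Box^{G}:\ \dfrac{M;\Gamma,P\vdash Q,\Delta;N,A}{M,\Gamma;P\vdash Q;\Delta,N,\Box A}\qquad\qquad \mathrm{L}\Diamond^{G}:\ \dfrac{A,M;\Gamma,P\vdash Q,\Delta;N}{\Diamond A,M,\Gamma;P\vdash Q;\Delta,N}$$ are admissible in $\mathrm{G3S5}^{;}$, where $A$ is a formula, $\Gamma$ and $\Delta$ are multisets of arbitrary formulas, $M,N$ are multisets of modal formulas and $P,Q$ are multisets of atomic formulas.
   Context: Formulas: $A::=\bot\mid\top\mid p\mid\neg A\mid A\wedge A\mid A\vee A\mid A\to A\mid\Diamond A\mid\Box A$ ($p$ a propositional variable); $\top$ is read as an abbreviation of $\neg\bot$. Atomic formulas are the variables and $\bot$; modal formulas are those of the form $\Diamond A$ or $\Box A$. Multisets are finite; a comma denotes multiset union; $\neg\Gamma=\{\neg A:A\in\Gamma\}$. $\bigwedge X$, $\bigvee X$ are the conjunction and disjunction of the members of the multiset $X$ (in a fixed order; just the member if $X$ is a singleton). Semicolon sequents. A sequent $\Gamma;P\vdash Q;\Delta$ consists of multisets of formulas $\Gamma,\Delta$, multisets $P,Q$ of atomic formulas (the middle part), and a partition of the occurrences in $P$ and $Q$ into nonempty blocks, each marked as a $\Diamond$-block or a $\Box$-block. A block consisting of $P_0$ from $P$ and $Q_0$ from $Q$ has corresponding formula $\Diamond\bigwedge(P_0,\neg Q_0)$ if it is a $\Diamond$-block and $\Box\bigvee(\neg P_0,Q_0)$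 if it is a $\Box$-block. The sequent stands for the ordinary sequent obtained by adding the corresponding formulas of all $\Diamond$-blocks to the antecedent $\Gamma$ and those of all $\Box$-blocks to the succedent $\Delta$. Semicolons next to an empty middle part are omitted; ordinary sequents $\Gamma\vdash\Delta$ have empty middle part. If a block contains a non-atomic formula, the notation abbreviates the sequent in which that block is deleted from the middle part and its corresponding formula is placed in the outer antecedent ($\Diamond$) or outer succedent ($\Box$). The system $\mathrm{G3S5}^{;}$ ($M,N$ multisets of modal formulas; $P,Q,P_i,Q_i$ multisets of atomic formulas; $\Gamma,\Delta$ arbitrary; premises before $\Rightarrow$, conclusion after). Axioms: $p,\Gamma;P\vdash Q;\Delta,p$ ($p$ atomic) and $\bot,\Gamma;P\vdash Q;\Delta$. L$\neg$: $\Gamma;P\vdash Q;\Delta,A\ \Rightarrow\ \neg A,\Gamma;P\vdash Q;\Delta$. R$\neg$: $A,\Gamma;P\vdash Q;\Delta\ \Rightarrow\ \Gamma;P\vdash Q;\Delta,\neg A$. L$\vee$: $A,\Gamma;P\vdash Q;\Delta$ and $B,\Gamma;P\vdash Q;\Delta\ \Rightarrow\ A\vee B,\Gamma;P\vdash Q;\Delta$. R$\vee$: $\Gamma;P\vdash Q;\Delta,A,B\ \Rightarrow\ \Gamma;P\vdash Q;\Delta,A\vee B$. L$\wedge$: $A,B,\Gamma;P\vdash Q;\Delta\ \Rightarrow\ A\wedge B,\Gamma;P\vdash Q;\Delta$. R$\wedge$: $\Gamma;P\vdash Q;\Delta,A$ and $\Gamma;P\vdash Q;\Delta,B\ \Rightarrow\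 \Gamma;P\vdash Q;\Delta,A\wedge B$. L$\to$: $\Gamma;P\vdash Q;\Delta,A$ and $B,\Gamma;P\vdash Q;\Delta\ \Rightarrow\ A\to B,\Gamma;P\vdash Q;\Delta$. R$\to$: $A,\Gamma;P\vdash Q;\Delta,B\ \Rightarrow\ \Gamma;P\vdash Q;\Delta,A\to B$. R$\Diamond$: $\Gamma;P\vdash Q;\Delta,\Diamond A,A\ \Rightarrow\ \Gamma;P\vdash Q;\Delta,\Diamond A$. L$\Box$: $A,\Box A,\Gamma;P\vdash Q;\Delta\ \Rightarrow\ \Box A,\Gamma;P\vdash Q;\Delta$. L$\Diamond$: $A,M;P_1,P_2\vdash Q_2,Q_1;N\ \Rightarrow\ \Diamond A,M,P_1;P_2\vdash Q_2;Q_1,N$. R$\Box$: $M;P_1,P_2\vdash Q_2,Q_1;N,A\ \Rightarrow\ M,P_1;P_2\vdash Q_2;Q_1,N,\Box A$. L$\Diamond^{;}$ and R$\Box^{;}$ (same shape): $M,P_2;P_1,P_3\vdash Q_3,Q_1;Q_2,N\ \Rightarrow\ M,P_1;P_2,P_3\vdash Q_3,Q_2;Q_1,N$. In the rules other than L$\Diamond$, R$\Box$, L$\Diamond^{;}$, R$\Box^{;}$ the marked partition is the same in premises and conclusion. In L$\Diamond$ (resp. R$\Box$) the premise has the blocks of the conclusion together with the new block formed by $P_1,Q_1$, marked $\Box$ (resp. $\Diamond$); no block is added if $P_1,Q_1$ are both empty. In L$\Diamond^{;}$ (resp. R$\Box^{;}$) $P_2,Q_2$ form one $\Diamond$-block (resp.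 $\Box$-block) of the conclusion; in the premise this block is removed, $P_1,Q_1$ form a new $\Box$-block (resp. $\Diamond$-block; none if empty), and the blocks of $P_3,Q_3$ are unchanged. A rule is admissible if, for each of its instances, provability of all premises in $\mathrm{G3S5}^{;}$ implies provability of the conclusion. In R$\Box^{G}$ (resp. L$\Diamond^{G}$) the premise has the blocks of the conclusion together with the new block formed by $\Gamma,\Delta$, with corresponding formula $\Diamond\bigwedge(\Gamma,\neg\Delta)$ in the antecedent (resp. $\Box\bigvee(\neg\Gamma,\Delta)$ in the succedent); no block is added if $\Gamma,\Delta$ are both empty. *)

(* Defs.v *)
From HB Require Import structures.
From mathcomp Require Import all_boot.
From mathcomp Require Import finmap multiset.

Set Implicit Arguments.
Unset Strict Implicit.
Unset Printing Implicit Defensive.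

Local Open Scope mset_scope.

Inductive formula : Type :=
  | Bot
  | Var of nat
  | Neg of formula
  | And of formula & formula
  | Or of formula & formula
  | Imp of formula & formula
  | Dia of formula
  | Box of formula.

Definition Top : formula := Neg Bot.

(* Countability of formulas, needed to form multisets of formulas. *)
Fixpoint tree_of_formula (A : formula) : GenTree.tree nat :=
  match A with
  | Bot => GenTree.Node 0 [::]
  | Var n => GenTree.Leaf n
  | Neg B => GenTree.Node 1 [:: tree_of_formula B]
  | And B C => GenTree.Node 2 [:: tree_of_formula B; tree_of_formula C]
  | Or B C => GenTree.Node 3 [:: tree_of_formula B; tree_of_formula C]
  | Imp B C => GenTree.Node 4 [:: tree_of_formula B; tree_of_formula C]
  | Dia B => GenTree.Node 5 [:: tree_of_formula B]
  | Box B => GenTree.Node 6 [:: tree_of_formula B]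
  end.

Fixpoint formula_of_tree (t : GenTree.tree nat) : formula :=
  match t with
  | GenTree.Leaf n => Var n
  | GenTree.Node 1 [:: t1] => Neg (formula_of_tree t1)
  | GenTree.Node 2 [:: t1; t2] => And (formula_of_tree t1) (formula_of_tree t2)
  | GenTree.Node 3 [:: t1; t2] => Or (formula_of_tree t1) (formula_of_tree t2)
  | GenTree.Node 4 [:: t1; t2] => Imp (formula_of_tree t1) (formula_of_tree t2)
  | GenTree.Node 5 [:: t1] => Dia (formula_of_tree t1)
  | GenTree.Node 6 [:: t1] => Box (formula_of_tree t1)
  | _ => Bot
  end.

Lemma tree_of_formulaK : cancel tree_of_formula formula_of_tree.
Proof. by elim=> //= [A -> | A -> B -> | A -> B -> | A -> B -> | A -> | A ->]. Qed.

HB.instance Definition _ := Countable.copy formula (can_type tree_of_formulaK).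

Definition atomic (A : formula) : bool :=
  match A with Bot | Var _ => true | _ => false end.

Definition modal (A : formula) : bool :=
  match A with Dia _ | Box _ => true | _ => false end.

Definition negs (X : {mset formula}) : {mset formula} :=
  seq_mset [seq Neg A | A <- enum_mset X].

Fixpoint big_and (A : formula) (s : seq formula) : formula :=
  if s is B :: s' then And A (big_and B s') else A.

Fixpoint big_or (A : formula) (s : seq formula) : formula :=
  if s is B :: s' then Or A (big_or B s') else A.

(* The members of X are taken in the fixed order of [enum_mset]. The values at
   the empty multiset are conventional: blocks are nonempty. *)
Definition conj_mset (X : {mset formula}) : formula :=
  if enum_mset X is A :: s then big_and A s else Top.

Definition disj_mset (X : {mset formula}) : formula :=
  if enum_mset X is A :: s then big_or A s else Bot.

Variant mark : Type := DiaMark | BoxMark.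

Definition bool_of_mark (k : mark) : bool := if k is DiaMark then true else false.
Definition mark_of_bool (b : bool) : mark := if b then DiaMark else BoxMark.

Lemma bool_of_markK : cancel bool_of_mark mark_of_bool.
Proof. by case. Qed.

HB.instance Definition _ := Countable.copy mark (can_type bool_of_markK).

(* (k, P, Q) is the block with mark k consisting of P (left of the turnstile)
   and Q (right of it). *)
Notation block := (mark * {mset formula} * {mset formula})%type.

Definition proper_block (b : block) : bool :=
  let: (_, P, Q) := b in
  [&& (P != mset0) || (Q != mset0), all atomic P & all atomic Q].

Definition block_formula (k : mark) (G D : {mset formula}) : formula :=
  match k with
  | DiaMark => Dia (conj_mset (G `+` negs D))
  | BoxMark => Box (disj_mset (negs G `+` D))
  end.

(* The middle part P |- Q with its marked partition is the multiset of its
   blocks: P and Q are the sums of the left and right components, so they are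
   not recorded separately. A middle part is required to be [proper]. *)
Notation middle := {mset block}.

Definition proper (m : middle) : bool := all proper_block m.

Record sequent : Type := Seq {
  ant : {mset formula};
  mid : middle;
  suc : {mset formula}
}.

Definition add_block (k : mark) (P Q : {mset formula}) (m : middle) : middle :=
  if (P == mset0) && (Q == mset0) then m else (k, P, Q) +` m.

(* The sequent denoted by the sequent s with an additional block of arbitrary
   formulas: if some formula of the block is not atomic, the corresponding
   formula goes to the outer part instead. *)
Definition with_block (k : mark) (G D : {mset formula}) (s : sequent) : sequent :=
  if all atomic G && all atomic D
  then Seq (ant s) (add_block k G D (mid s)) (suc s)
  else match k with
       | DiaMark => Seq (block_formula k G D +` ant s) (mid s) (suc s)
       | BoxMark => Seq (ant s) (mid s) (block_formula k G D +` suc s)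
       end.

(* Provability in G3S5;. The middle part of an axiom is required to be proper;
   it follows that all middle parts occurring in a derivation are proper. *)
Inductive provable : sequent -> Prop :=
  | ax_atom p G m D :
      atomic p -> proper m ->
      provable (Seq (p +` G) m (p +` D))
  | ax_bot G m D :
      proper m ->
      provable (Seq (Bot +` G) m D)
  | L_neg A G m D :
      provable (Seq G m (A +` D)) ->
      provable (Seq (Neg A +` G) m D)
  | R_neg A G m D :
      provable (Seq (A +` G) m D) ->
      provable (Seq G m (Neg A +` D))
  | L_or A B G m D :
      provable (Seq (A +` G) m D) ->
      provable (Seq (B +` G) m D) ->
      provable (Seq (Or A B +` G) m D)
  | R_or A B G m D :
      provable (Seq G m (A +` (B +` D))) ->
      provable (Seq G m (Or A B +` D))
  | L_and A B G m D :
      provable (Seq (A +` (B +` G)) m D) ->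
      provable (Seq (And A B +` G) m D)
  | R_and A B G m D :
      provable (Seq G m (A +` D)) ->
      provable (Seq G m (B +` D)) ->
      provable (Seq G m (And A B +` D))
  | L_imp A B G m D :
      provable (Seq G m (A +` D)) ->
      provable (Seq (B +` G) m D) ->
      provable (Seq (Imp A B +` G) m D)
  | R_imp A B G m D :
      provable (Seq (A +` G) m (B +` D)) ->
      provable (Seq G m (Imp A B +` D))
  | R_dia A G m D :
      provable (Seq G m (Dia A +` (A +` D))) ->
      provable (Seq G m (Dia A +` D))
  | L_box A G m D :
      provable (Seq (A +` (Box A +` G)) m D) ->
      provable (Seq (Box A +` G) m D)
  | L_dia A (M N P1 Q1 : {mset formula}) m :
      all modal M -> all modal N -> all atomic P1 -> all atomic Q1 ->
      provable (Seq (A +` M) (add_block BoxMark P1 Q1 m) N) ->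
      provable (Seq (Dia A +` (M `+` P1)) m (Q1 `+` N))
  | R_box A (M N P1 Q1 : {mset formula}) m :
      all modal M -> all modal N -> all atomic P1 -> all atomic Q1 ->
      provable (Seq M (add_block DiaMark P1 Q1 m) (A +` N)) ->
      provable (Seq (M `+` P1) m (Box A +` (Q1 `+` N)))
  | L_dia_semi (M N P1 Q1 P2 Q2 : {mset formula}) m :
      all modal M -> all modal N -> all atomic P1 -> all atomic Q1 ->
      proper_block (DiaMark, P2, Q2) ->
      provable (Seq (M `+` P2) (add_block BoxMark P1 Q1 m) (Q2 `+` N)) ->
      provable (Seq (M `+` P1) ((DiaMark, P2, Q2) +` m) (Q1 `+` N))
  | R_box_semi (M N P1 Q1 P2 Q2 : {mset formula}) m :
      all modal M -> all modal N -> all atomic P1 -> all atomic Q1 ->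
      proper_block (BoxMark, P2, Q2) ->
      provable (Seq (M `+` P2) (add_block DiaMark P1 Q1 m) (Q2 `+` N)) ->
      provable (Seq (M `+` P1) ((BoxMark, P2, Q2) +` m) (Q1 `+` N)).

(* A rule is the set of its instances (premises, conclusion). *)
Definition rule : Type := seq sequent -> sequent -> Prop.

Definition admissible (r : rule) : Prop :=
  forall (prems : seq sequent) (concl : sequent),
    r prems concl ->
    (forall i, i < size prems -> provable (nth concl prems i)) ->
    provable concl.

Inductive RBoxG : rule :=
  | RBoxG_intro A (M N G D : {mset formula}) (m : middle) :
      all modal M -> all modal N -> proper m ->
      RBoxG [:: with_block DiaMark G D (Seq M m (A +` N))]
            (Seq (M `+` G) m (Box A +` (D `+` N))).

Inductive LDiaG : rule :=
  | LDiaG_intro A (M N G D : {mset formula}) (m : middle) :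
      all modal M -> all modal N -> proper m ->
      LDiaG [:: with_block BoxMark G D (Seq (A +` M) m N)]
            (Seq (Dia A +` (M `+` G)) m (D `+` N)).

(* Main.v *)
(** The formula of a non-atomic block [Gamma |- Delta], for instance
    [<>(/\ Gamma, ~Delta)] in the antecedent, can be replaced in a proof as
    follows. Decompose [Gamma |- Delta] by the (invertible) propositional rules
    into sequents [M1, P1 |- Q1, N1] of modal and atomic formulas. For each of
    them the modal formulas can be put into the outer part and [P1 |- Q1] into
    the middle part, by induction on the proof: where the block formula is
    principal, the step is simulated by inversion followed by a jump to the
    block [P1 |- Q1]. This gives the premise of the original rule R[] (or L<>)
    for each leaf of the decomposition of the conclusion. If [P1 |- Q1] is empty
    there is no block to jump to; then one uses that two blocks, or a block and
    the outer part, can be merged. *)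
From mathcomp Require Import all_boot.
From mathcomp Require Import finmap multiset zify.
Require Import Defs.

Set Implicit Arguments.
Unset Strict Implicit.
Unset Printing Implicit Defensive.

Local Open Scope mset_scope.

(** * Finite multisets: induction, cancellation, splitting off an element *)

Lemma msetDE (K : choiceType) (A B : {mset K}) a : (A `+` B) a = A a + B a.
Proof. by rewrite !msetE2. Qed.

Ltac mset_ac := apply/msetP => ?; rewrite !msetDE; lia.

Lemma seq_mset_nil (K : choiceType) : seq_mset [::] = mset0 :> {mset K}.
Proof. by apply/msetP => a; rewrite mset_seqE mset0E. Qed.

Lemma mset_ind (K : choiceType) (P : {mset K} -> Prop) :
  P mset0 -> (forall x X, P X -> P (x +` X)) -> forall X, P X.
Proof.
move=> P0 Pcons X; rewrite -(seq_mset_id X).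
by elim: (enum_mset X) => [|x s IH]; rewrite ?seq_mset_nil ?mset_cons //; apply: Pcons.
Qed.

Lemma mset_in_cons (K : choiceType) x (X : {mset K}) :
  x \in X -> exists Y, X = x +` Y.
Proof. by move=> xX; exists (X `\ x); rewrite msetB1K. Qed.

Lemma msetDI (K : choiceType) (A B C : {mset K}) : A `+` B = A `+` C -> B = C.
Proof. by move=> E; apply/msetP => a; move/msetP/(_ a): E; rewrite !msetDE; lia. Qed.

(** Compares the principal formula of a rule with the formula traced through the derivation: they
    coincide, or each lies in the context of the other. Also used for the blocks of a middle
    part. *)
Lemma mset_consI (K : choiceType) x y (X Y : {mset K}) :
  x +` X = y +` Y ->
  x = y /\ X = Y \/ x <> y /\ exists2 Z, X = y +` Z & Y = x +` Z.
Proof.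
move=> E; case: (eqVneq x y) => [xy|/eqP xy]; [left|right]; split=> //.
  by move: E; rewrite xy; apply: msetDI.
have /mset_in_cons[Z XZ] : y \in X.
  have: y \in x +` X by rewrite E mset1D1.
  by rewrite in_mset1D => /orP[/eqP yx|//]; case: xy.
exists Z => //; apply: (@msetDI _ [mset y]).
by rewrite -E XZ msetDCA.
Qed.

Lemma mset_cons_in (K : choiceType) x (X A B : {mset K}) :
  x +` X = A `+` B -> x \in A \/ x \in B.
Proof. by move=> E; apply/msetDP; rewrite -E mset1D1. Qed.

Lemma all_msetD (K : choiceType) (p : pred K) (A B : {mset K}) :
  all p (A `+` B) = all p A && all p B.
Proof.
apply/allP/andP => [H|[/allP HA /allP HB] x /msetDP[/HA|/HB]//].
by split; apply/allP => x xX; apply: H; apply/msetDP; [left|right].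
Qed.

Lemma all_mset1 (K : choiceType) (p : pred K) x : all p [mset x] = p x.
Proof. by apply/allP/idP => [->|px y /mset1P->//]; rewrite ?in_mset1. Qed.

Lemma all_mset0 (K : choiceType) (p : pred K) : all p (mset0 : {mset K}).
Proof. by apply/allP => x; rewrite in_mset0. Qed.

Lemma msetD_eq0 (K : choiceType) (A B : {mset K}) :
  (A `+` B == mset0) = (A == mset0) && (B == mset0).
Proof.
apply/eqP/andP => [E|[/eqP-> /eqP->]]; last by rewrite msetD0.
by split; apply/eqP/msetP => a; move/msetP/(_ a): E; rewrite msetDE mset0E; lia.
Qed.

Lemma mset_cons_neq0 (K : choiceType) x (X : {mset K}) : x +` X != mset0.
Proof. by apply/eqP => /msetP/(_ x); rewrite msetDE mset0E msetnxx. Qed.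

(** * Images of multisets *)

Definition mmap (K L : choiceType) (f : K -> L) (X : {mset K}) : {mset L} :=
  seq_mset [seq f x | x <- enum_mset X].

Lemma mmap0 (K L : choiceType) (f : K -> L) : mmap f mset0 = mset0.
Proof. by rewrite /mmap enum_mset0 seq_mset_nil. Qed.

(** The enumeration of the enlarged multiset is only a permutation of [x :: enum_mset X], which is
    enough after [seq_mset]. *)
Lemma mmap_cons (K L : choiceType) (f : K -> L) x X :
  mmap f (x +` X) = f x +` mmap f X.
Proof.
rewrite /mmap -mset_cons; apply/eq_seq_msetP.
rewrite -map_cons; apply: perm_map.
have : perm_eq (seq_mset (x :: X)) (x :: X) by apply: perm_eq_seq_mset.
by rewrite mset_cons seq_mset_id.
Qed.

Lemma mmapD (K L : choiceType) (f : K -> L) X Y :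
  mmap f (X `+` Y) = mmap f X `+` mmap f Y.
Proof.
elim/mset_ind: X => [|x X IH]; first by rewrite mmap0 !mset0D.
by rewrite -msetDA !mmap_cons IH msetDA.
Qed.

Lemma all_mmap (K L : choiceType) (f : K -> L) (p : pred L) X :
  all p (mmap f X) = all (fun x => p (f x)) X.
Proof.
elim/mset_ind: X => [|x X IH]; first by rewrite mmap0 !all_mset0.
by rewrite mmap_cons !all_msetD !all_mset1 IH.
Qed.

Lemma mmap_in (K L : choiceType) (f : K -> L) y X :
  y \in mmap f X -> exists2 x, x \in X & y = f x.
Proof.
elim/mset_ind: X => [|x X IH]; first by rewrite mmap0 in_mset0.
rewrite mmap_cons in_mset1D => /orP[/eqP->|/IH[x' x'X ->]].
  by exists x => //; rewrite mset1D1.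
by exists x' => //; rewrite mset1Dr.
Qed.

Lemma mmap_consE (K L : choiceType) (f : K -> L) X y Y :
  mmap f X = y +` Y -> exists x Z, [/\ X = x +` Z, y = f x & Y = mmap f Z].
Proof.
move=> E; have /mmap_in[x /mset_in_cons[Z XZ] yx] : y \in mmap f X.
  by rewrite E mset1D1.
exists x, Z; split=> //; apply: (@msetDI _ [mset y]).
by rewrite -E XZ mmap_cons yx.
Qed.

Lemma mmap_eq0 (K L : choiceType) (f : K -> L) X :
  (mmap f X == mset0) = (X == mset0).
Proof.
elim/mset_ind: X => [|x X _]; first by rewrite mmap0 !eqxx.
by rewrite mmap_cons !(negbTE (mset_cons_neq0 _ _)).
Qed.

(** * The calculus on signed formulas with unmarked blocks *)

(* [(true, A)] is an occurrence of A in the antecedent, [(false, A)] one in the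
   succedent. *)
Local Notation sformula := (bool * formula)%type.

Definition satomic (s : sformula) := atomic s.2.
Definition smodal (s : sformula) := modal s.2.
Definition compound (s : sformula) := ~~ satomic s && ~~ smodal s.

(** A diamond in the antecedent and a box in the succedent behave alike, so the single rule
    [prv_new] covers [L_dia] and [R_box]. Dually, [necessity] lets [prv_refl] cover [L_box] and
    [R_dia]. *)
Definition possibility (s : sformula) : bool :=
  match s with (true, Dia _) | (false, Box _) => true | _ => false end.

Definition necessity (s : sformula) : bool :=
  match s with (false, Dia _) | (true, Box _) => true | _ => false end.

Definition scope (s : sformula) : sformula :=
  match s.2 with Dia A | Box A => (s.1, A) | _ => s end.

(** One multiset for each premise of the propositional rule for [s]. The empty list at atomic and
    modal formulas is a default, kept out of [prv_prop] by [compound]. *)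
Definition decomp (s : sformula) : seq {mset sformula} :=
  match s with
  | (b, Neg A) => [:: [mset (~~ b, A)] ]
  | (true, And A B) => [:: [mset (true, A); (true, B)] ]
  | (false, And A B) => [:: [mset (false, A)]; [mset (false, B)] ]
  | (true, Or A B) => [:: [mset (true, A)]; [mset (true, B)] ]
  | (false, Or A B) => [:: [mset (false, A); (false, B)] ]
  | (true, Imp A B) => [:: [mset (false, A)]; [mset (true, B)] ]
  | (false, Imp A B) => [:: [mset (true, A); (false, B)] ]
  | _ => [::]
  end.

Local Notation world := {mset sformula}.
Local Notation worlds := {mset world}.

Definition proper_world (W : world) := (W != mset0) && all satomic W.

Definition add_world (W : world) (m : worlds) :=
  if W == mset0 then m else W +` m.

(* The calculus with signed formulas and without the marks of blocks:
   [provable_of_prv] shows that the marks are irrelevant. *)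
Inductive prv : world -> worlds -> Prop :=
  | prv_ax p (X : world) (m : worlds) : atomic p -> all proper_world m ->
      prv ((true, p) +` ((false, p) +` X)) m
  | prv_bot (X : world) (m : worlds) : all proper_world m -> prv ((true, Bot) +` X) m
  | prv_prop s (X : world) (m : worlds) : compound s ->
      (forall Y, Y \in decomp s -> prv (Y `+` X) m) -> prv (s +` X) m
  | prv_refl s (X : world) (m : worlds) : necessity s ->
      prv (scope s +` (s +` X)) m -> prv (s +` X) m
  | prv_new s (M W : world) (m : worlds) : possibility s -> all smodal M -> all satomic W ->
      prv (scope s +` M) (add_world W m) -> prv (s +` (M `+` W)) m
  | prv_jump (M W V : world) (m : worlds) : all smodal M -> all satomic W -> proper_world V ->
      prv (M `+` V) (add_world W m) -> prv (M `+` W) (V +` m).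

Lemma prv_ax_in p (X : world) (m : worlds) : atomic p -> all proper_world m ->
  (true, p) \in X -> (false, p) \in X -> prv X m.
Proof.
move=> ap pm /mset_in_cons[Y ->]; rewrite in_mset1D => /orP[/eqP//|].
by move=> /mset_in_cons[Z ->]; apply: prv_ax.
Qed.

Lemma prv_bot_in (X : world) (m : worlds) : all proper_world m -> (true, Bot) \in X -> prv X m.
Proof. by move=> pm /mset_in_cons[Y ->]; apply: prv_bot. Qed.

Lemma possibility_modal s : possibility s -> smodal s.
Proof. by case: s => -[] []. Qed.

Lemma necessity_modal s : necessity s -> smodal s.
Proof. by case: s => -[] []. Qed.

Lemma possibilityN s : possibility s -> ~~ necessity s.
Proof. by case: s => -[] []. Qed.

Lemma smodal_atomicN s : smodal s -> ~~ satomic s.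
Proof. by case: s => b []. Qed.

Lemma compoundNmodal s : compound s -> ~~ smodal s.
Proof. by case/andP. Qed.

Lemma add_world_cons W V m : add_world W (V +` m) = V +` add_world W m.
Proof. by rewrite /add_world; case: ifP => _; rewrite ?[W +` _]msetDCA. Qed.

Lemma add_worldC W V m :
  add_world W (add_world V m) = add_world V (add_world W m).
Proof. by rewrite {2 3}/add_world; case: ifP => _; rewrite ?add_world_cons. Qed.

Lemma proper_add_world (W : world) (m : worlds) :
  all satomic W -> all proper_world m -> all proper_world (add_world W m).
Proof.
rewrite /add_world; case: ifP => // W0 aW pm.
by rewrite all_msetD all_mset1 /proper_world W0 aW.
Qed.

Lemma add_world0 m : add_world mset0 m = m.
Proof. by rewrite /add_world eqxx. Qed.

Lemma add_worldN (W : world) m : W != mset0 -> add_world W m = W +` m.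
Proof. by rewrite /add_world => /negbTE->. Qed.

(** * Inversion of the propositional rules *)

(** Induction on the derivation. Where [s] is principal, the wanted sequent is one of the premises;
    in the other propositional and reflexivity steps the rule is applied again below the induction
    hypothesis. *)
Lemma prv_decomp s (X Y : world) (m : worlds) :
  compound s -> Y \in decomp s -> prv (s +` X) m -> prv (Y `+` X) m.
Proof.
move=> cs Ys; move E: (s +` X) => X0 d; elim: d X E => {X0 m}.
- move=> p X0 m ap pm X E.
  have H b : (b, p) \in s +` X -> (b, p) \in Y `+` X.
    rewrite in_mset1D in_msetD => /orP[/eqP es|->]; last by rewrite orbT.
    by move: cs; rewrite -es /compound /satomic ap.
  apply: (prv_ax_in ap pm); apply: H; rewrite E; first by rewrite mset1D1.
  by rewrite msetDCA mset1D1.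
- move=> X0 m pm X E; apply: (prv_bot_in pm).
  have: (true, Bot) \in s +` X by rewrite E mset1D1.
  rewrite in_mset1D in_msetD => /orP[/eqP es|->]; last by rewrite orbT.
  by move: cs; rewrite -es.
- move=> t X0 m ct dX IH X /mset_consI[[st ->]|[_ [Z -> EX]]].
    by apply: dX; rewrite -st.
  rewrite msetDCA; apply: prv_prop => // V Vt.
  by rewrite msetDCA; apply: (IH V) => //; rewrite EX msetDCA.
- move=> t X0 m nt dX IH X /mset_consI[[st _]|[_ [Z -> EX]]].
    by move/compoundNmodal: cs; rewrite st necessity_modal.
  rewrite msetDCA; apply: prv_refl => //.
  rewrite [t +` _]msetDCA [scope t +` _]msetDCA; apply: IH.
  by rewrite EX; mset_ac.
(* The conclusions of the last two rules contain only modal and atomic formulas outside the blocks,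
   so the compound [s] cannot occur there. *)
- move=> t M W m pt mM aW _ _ X /mset_consI[[st _]|[_ [Z _ E]]].
    by move/compoundNmodal: cs; rewrite st possibility_modal.
  case/andP: cs => /negP asN /negP msN.
  by case: (mset_cons_in (esym E)) => [/(allP mM)|/(allP aW)].
- move=> M W V m mM aW _ _ _ X E.
  case/andP: cs => /negP asN /negP msN.
  by case: (mset_cons_in E) => [/(allP mM)|/(allP aW)].
Qed.

(** * Merging two blocks, or a block and the outer part *)

(* The two parts need a simultaneous induction: jumping to one of two merged
   blocks turns a merge of blocks into a merge with the outer part, and a rule
   that stores the outer part does the opposite. *)
Lemma prv_merge (X : world) (m0 : worlds) : prv X m0 ->
  (forall W m, proper_world W -> m0 = W +` m -> prv (W `+` X) m) /\
  (forall W V m, proper_world W -> proper_world V -> m0 = W +` (V +` m) ->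
     prv X ((W `+` V) +` m)).
Proof.
have proper_merge (W V : world) :
    proper_world W -> proper_world V -> proper_world (W `+` V).
  move=> /andP[W0 aW] /andP[_ aV]; rewrite /proper_world msetD_eq0 negb_and W0 /=.
  by rewrite all_msetD aW aV.
have all_merge (W V : world) (m : worlds) : proper_world W -> proper_world V ->
    all proper_world (W +` (V +` m)) -> all proper_world ((W `+` V) +` m).
  by move=> pW pV; rewrite !all_msetD !all_mset1 proper_merge // => /and3P[].
(* The rule now stores [U] together with the merged [W]. If [U] is empty, the premise has no new
   block and its block [W] is already the one to be stored; otherwise the blocks [U] and [W] are
   merged by the second part. *)
have merge_add (Y U W : world) (m m0' : worlds) : all satomic U ->
    proper_world W -> prv Y (add_world U m0') -> m0' = W +` m ->
    (forall W V m, proper_world W -> proper_world V ->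
       add_world U m0' = W +` (V +` m) -> prv Y ((W `+` V) +` m)) ->
    prv Y (add_world (U `+` W) m).
  move=> aU pW d Em IH; case: (eqVneq U mset0) => [U0|U0].
    have W0 : W != mset0 by case/andP: pW.
    by move: d; rewrite U0 mset0D add_world0 (add_worldN _ W0) Em.
  have UW0 : U `+` W != mset0 by rewrite msetD_eq0 negb_and U0.
  rewrite (add_worldN _ UW0); apply: IH => //; first by apply/andP.
  by rewrite add_worldN // Em.
elim=> {X m0}.
- move=> p X m0 ap pm0; split=> [W m pW Em|W V m pW pV Em].
    move: pm0; rewrite Em all_msetD => /andP[_ pm].
    by apply: (prv_ax_in ap pm); rewrite !in_msetD !in_mset1 eqxx !orbT.
  by apply: prv_ax => //; apply: all_merge => //; rewrite -Em.
- move=> X m0 pm0; split=> [W m pW Em|W V m pW pV Em].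
    move: pm0; rewrite Em all_msetD => /andP[_ pm].
    by apply: (prv_bot_in pm); rewrite !in_msetD !in_mset1 eqxx !orbT.
  by apply: prv_bot => //; apply: all_merge => //; rewrite -Em.
- move=> s X m0 cs _ IH; split=> [W m pW Em|W V m pW pV Em].
    rewrite msetDCA; apply: prv_prop => // Y /IH[IH1 _].
    by rewrite msetDCA; apply: IH1.
  by apply: prv_prop => // Y /IH[_ IH2]; apply: IH2.
- move=> s X m0 ns _ [IH1 IH2]; split=> [W m pW Em|W V m pW pV Em].
    rewrite msetDCA; apply: prv_refl => //.
    by rewrite [s +` _]msetDCA [scope s +` _]msetDCA; apply: IH1.
  by apply: prv_refl => //; apply: IH2.
- move=> s M U m0 ps mM aU d [IH1 IH2]; split=> [W m pW Em|W V m pW pV Em].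
    have ->: W `+` (s +` (M `+` U)) = s +` (M `+` (U `+` W)) by mset_ac.
    apply: prv_new => //; first by rewrite all_msetD aU; case/andP: pW.
    exact: (merge_add _ _ _ _ m0).
  apply: prv_new => //; rewrite add_world_cons; apply: IH2 => //.
  by rewrite Em !add_world_cons.
- move=> M U V0 m0 mM aU pV0 d [IH1 IH2].
  split=> [W m pW /mset_consI[[EV <-]|[_ [Z Em ->]]]|W V m pW pV].
  (* The jump opens the very block being merged. The premise then differs from the goal only in
     holding [U] as a block, which the first part moves outside; if [U] is empty, the premise is the
     goal. *)
  + case: (eqVneq U mset0) => [U0|U0].
      by move: d; rewrite U0 EV add_world0 msetD0 msetDC.
    have ->: W `+` (M `+` U) = U `+` (M `+` V0) by rewrite EV; mset_ac.
    by apply: IH1; [apply/andP | rewrite add_worldN].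
  + have ->: W `+` (M `+` U) = M `+` (U `+` W) by mset_ac.
    apply: prv_jump => //; first by rewrite all_msetD aU; case/andP: pW.
    exact: (merge_add _ _ _ _ m0).
  (* The jump opens [V0], one of the two merged blocks. Jumping to the merged block instead brings
     the other one, [W'], into the outer part of the premise, as the first part allows. *)
  + have opened (W' : world) : proper_world W' -> m0 = W' +` m ->
        prv (M `+` U) ((V0 `+` W') +` m).
      move=> pW' Em; apply: prv_jump => //; first exact: proper_merge.
      have ->: M `+` (V0 `+` W') = W' `+` (M `+` V0) by mset_ac.
      by apply: IH1 => //; rewrite Em add_world_cons.
    case/mset_consI=> [[<- Em]|[_ [Z Em /esym E]]]; first exact: opened.
    case/mset_consI: E => [[EV EZ]|[_ [Z' EZ ->]]].
      by rewrite msetDC [W `+` V]msetDC -EV msetDC; apply: opened => //; rewrite Em EZ.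
    rewrite [_ +` (V0 +` _)]msetDCA; apply: prv_jump => //.
    by rewrite add_world_cons; apply: IH2 => //; rewrite Em EZ !add_world_cons.
Qed.

(** * Replacing a possibility by a leaf of its decomposition *)

Lemma mset_consD (K : choiceType) x (X A B : {mset K}) :
  x \notin B -> x +` X = A `+` B -> exists2 C, A = x +` C & X = C `+` B.
Proof.
move=> xB E; case: (mset_cons_in E) => [/mset_in_cons[C AC]|]; last by rewrite (negbTE xB).
by exists C => //; apply: (@msetDI _ [mset x]); rewrite E AC msetDA.
Qed.

(* [M1, W1] stands for a leaf of the decomposition of [scope s]; all that is
   needed of it is the inversion property. *)
Lemma prv_unfold s (X M1 W1 : world) (m : worlds) :
  possibility s -> all smodal M1 -> all satomic W1 ->
  (forall (Y : world) m, prv (scope s +` Y) m -> prv ((M1 `+` W1) `+` Y) m) ->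
  prv (s +` X) m -> prv (M1 `+` X) (add_world W1 m).
Proof.
move=> ps mM1 aW1 refine; move E: (s +` X) => X0 d.
have sN (W : world) : all satomic W -> s \notin W.
  move=> aW; apply/negP => /(allP aW); apply/negP.
  exact/smodal_atomicN/possibility_modal.
have keep b p (Y : world) : atomic p -> (b, p) \in s +` Y -> (b, p) \in M1 `+` Y.
  rewrite in_mset1D in_msetD => ap /orP[/eqP es|->]; last by rewrite orbT.
  by move/possibility_modal/smodal_atomicN: ps; rewrite -es /satomic ap.
elim: d X E => {X0 m}.
- move=> p X0 m ap pm X E; have pm' := proper_add_world aW1 pm.
  apply: (prv_ax_in ap pm'); apply: keep => //; rewrite E ?mset1D1 //.
  by rewrite msetDCA mset1D1.
- move=> X0 m pm X E; have pm' := proper_add_world aW1 pm.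
  by apply: (prv_bot_in pm'); apply: keep => //; rewrite E mset1D1.
- move=> t X0 m ct dX IH X /mset_consI[[st _]|[_ [Z -> EX]]].
    by move/compoundNmodal: ct; rewrite -st possibility_modal.
  rewrite msetDCA; apply: prv_prop => // V Vt.
  by rewrite msetDCA; apply: (IH V) => //; rewrite EX msetDCA.
- move=> t X0 m nt dX IH X /mset_consI[[st _]|[_ [Z -> EX]]].
    by move: nt; rewrite -st (negbTE (possibilityN ps)).
  rewrite msetDCA; apply: prv_refl => //.
  rewrite [t +` _]msetDCA [scope t +` _]msetDCA; apply: IH.
  by rewrite EX; mset_ac.
- move=> t M W m pt mM aW d IH X /mset_consI[[st ->]|[_ [Z -> /esym EX]]].
    (* Here [s] is principal: [refine] turns its scope in the premise into the leaf [M1], [W1]. *)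
    have {d} := d; rewrite -st => /refine d.
    (* For nonempty [W1] a jump to the block [W1] stores [W] as the premise does. For empty [W1]
       there is nothing to jump to, and the stored block [W] is merged back into the outer part. *)
    case: (eqVneq W1 mset0) => [W10|W10].
      move: d; rewrite W10 msetD0 add_world0.
      case: (eqVneq W mset0) => [->|W0]; first by rewrite add_world0 msetD0.
      have pW : proper_world W by apply/andP.
      rewrite (add_worldN _ W0) => /prv_merge[/(_ _ _ pW erefl) d _].
      by rewrite msetDA msetDC.
    rewrite (add_worldN _ W10) msetDA; apply: prv_jump => //.
    - by rewrite all_msetD mM1.
    - exact/andP.
    - by rewrite msetDAC.
  (* Being modal, [s] lies in [M] and not in the atomic [W], so it survives into the premise, where
     the induction hypothesis replaces it. *)
  case: (mset_consD (sN _ aW) EX) => M' EM ->.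
  have ->: M1 `+` (t +` (M' `+` W)) = t +` ((M1 `+` M') `+` W) by mset_ac.
  have mM' : all smodal M' by move: mM; rewrite EM all_msetD => /andP[].
  apply: prv_new => //; first by rewrite all_msetD mM1.
  rewrite add_worldC msetDCA; apply: IH.
  by rewrite EM msetDCA.
- move=> M W V m mM aW pV d IH X E.
  case: (mset_consD (sN _ aW) E) => M' EM ->.
  have mM' : all smodal M' by move: mM; rewrite EM all_msetD => /andP[].
  rewrite add_world_cons msetDA; apply: prv_jump => //.
    by rewrite all_msetD mM1.
  rewrite add_worldC -msetDA; apply: IH.
  by rewrite EM msetDA.
Qed.

(** * Decomposition into modal and atomic formulas, and the general rule *)

Fixpoint fsize (A : formula) : nat :=
  match A with
  | Bot | Var _ => 1
  | Neg B | Dia B | Box B => (fsize B).+1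
  | And B C | Or B C | Imp B C => (fsize B + fsize C).+1
  end.

Definition weight (X : world) : nat := \sum_(s <- enum_mset X) fsize s.2.

Lemma weight1 s : weight [mset s] = fsize s.2.
Proof. by rewrite /weight enum_msetn big_seq1. Qed.

Lemma weightD (X Y : world) : weight (X `+` Y) = weight X + weight Y.
Proof.
have cons s (Z : world) : weight (s +` Z) = fsize s.2 + weight Z.
  rewrite /weight -[in LHS](seq_mset_id Z) -mset_cons.
  by rewrite (perm_big _ (perm_eq_seq_mset (s :: Z))) big_cons.
elim/mset_ind: X => [|s X IH].
  by rewrite mset0D /weight enum_mset0 big_nil.
by rewrite -msetDA !cons IH addnA.
Qed.

Lemma weight_decomp s (Y : world) : Y \in decomp s -> weight Y < fsize s.2.
Proof.
have d1 (Z : world) n : weight Z < n -> Y \in [:: Z] -> weight Y < n.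
  by rewrite inE => ltZ /eqP->.
have d2 (Z1 Z2 : world) n :
    weight Z1 < n -> weight Z2 < n -> Y \in [:: Z1; Z2] -> weight Y < n.
  by move=> lt1 lt2; rewrite !inE => /orP[]/eqP->.
case: s => -[] [] //= *; first [apply: d1; last eassumption | apply: d2; last eassumption].
all: by rewrite ?weightD !weight1 /=; lia.
Qed.

Lemma mset_split (K : choiceType) (p : pred K) (X : {mset K}) :
  exists A B, [/\ X = A `+` B, all p A & all (predC p) B].
Proof.
elim/mset_ind: X => [|x X [A [B [-> pA pB]]]].
  by exists mset0, mset0; rewrite msetD0 !all_mset0.
case px: (p x).
  by exists (x +` A), B; rewrite msetDA all_msetD all_mset1 px.
by exists A, (x +` B); rewrite msetDCA all_msetD all_mset1 /= px.
Qed.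

(** Here [s0] is the signed block formula, [G] the content of the block and [s] the principal
    formula. Induction on the weight of [G] decomposes it by propositional rules; at a leaf,
    [prv_new] stores the atomic part and [prv_unfold] supplies its premise. *)
Lemma prv_general s0 s (M G : world) (m : worlds) :
  possibility s0 -> possibility s -> all smodal M ->
  (forall (Y : world) m, prv (scope s0 +` Y) m -> prv (G `+` Y) m) ->
  prv (s0 +` (scope s +` M)) m -> prv (s +` (M `+` G)) m.
Proof.
move=> ps0 ps mM refine d.
have [n leGn] := ubnP (weight G).
elim: n G leGn refine => // n IH G leGn refine.
case: (boolP (has compound G)) => [/hasP[t tG ct]|/hasPn ncG].
  have [G' EG] := mset_in_cons tG.
  have ->: s +` (M `+` G) = t +` (s +` (M `+` G')) by rewrite EG; mset_ac.
  apply: prv_prop => // Y Yt.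
  have ->: Y `+` (s +` (M `+` G')) = s +` (M `+` (Y `+` G')) by mset_ac.
  (* The inversion property is inherited by each branch, because the propositional rule just applied
     is itself invertible. *)
  apply: IH => [|Z m' /refine].
    move: leGn; rewrite EG !weightD weight1 ltnS; apply: leq_trans.
    by rewrite ltn_add2r weight_decomp.
  by rewrite EG -!msetDA; apply: prv_decomp.
have [M1 [W1 [EG mM1 nmW1]]] := mset_split smodal G.
(* A formula that is neither modal nor compound is atomic. *)
have aW1 : all satomic W1.
  apply/allP => t tW1; have := allP nmW1 _ tW1; have := ncG t.
  by rewrite EG in_msetD tW1 orbT negb_and !negbK => /(_ isT)/orP[|/= ->].
rewrite EG [M `+` _]msetDA; apply: prv_new => //; first by rewrite all_msetD mM.
have ->: scope s +` (M `+` M1) = M1 `+` (scope s +` M) by mset_ac.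
by apply: (prv_unfold (s := s0)) => //; rewrite -EG.
Qed.

(** * Inversion of iterated negations, conjunctions and disjunctions *)

Lemma prv_negs b (D : {mset formula}) (X : world) (m : worlds) :
  prv (mmap (pair b) (negs D) `+` X) m -> prv (mmap (pair (~~ b)) D `+` X) m.
Proof.
(* [negs] is [mmap Neg] by conversion. *)
rewrite /negs -/(mmap Neg D).
elim/mset_ind: D X => [|A D IH] X; first by rewrite !mmap0.
rewrite !mmap_cons -!msetDA.
have Yin : [mset (~~ b, A)] \in decomp (b, Neg A) by case: (b); rewrite inE.
by move/(prv_decomp (isT : compound (b, Neg A)) Yin); rewrite msetDCA => /IH; rewrite msetDCA.
Qed.

(** Repeated inversion of the conjunction along the enumeration, moving each conjunct into [X].
    Nonemptiness excludes the conventional value [Top]. *)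
Lemma prv_conj (G : {mset formula}) (X : world) (m : worlds) :
  G != mset0 -> prv ((true, conj_mset G) +` X) m -> prv (mmap (pair true) G `+` X) m.
Proof.
rewrite /conj_mset /mmap -size_mset_eq0.
case: (enum_mset G) => // A s _.
elim: s A X => [|B s IH] A X /=; first by rewrite mset_cons seq_mset_nil msetD0.
have Yin : [mset (true, A); (true, big_and B s)] \in decomp (true, And A (big_and B s)).
  by rewrite inE.
move/(prv_decomp (isT : compound (true, And A _)) Yin); rewrite -msetDA msetDCA => /IH.
by rewrite [in X in _ -> X]mset_cons -msetDA msetDCA.
Qed.

Lemma prv_disj (G : {mset formula}) (X : world) (m : worlds) :
  G != mset0 -> prv ((false, disj_mset G) +` X) m -> prv (mmap (pair false) G `+` X) m.
Proof.
rewrite /disj_mset /mmap -size_mset_eq0.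
case: (enum_mset G) => // A s _.
elim: s A X => [|B s IH] A X /=; first by rewrite mset_cons seq_mset_nil msetD0.
have Yin : [mset (false, A); (false, big_or B s)] \in decomp (false, Or A (big_or B s)).
  by rewrite inE.
move/(prv_decomp (isT : compound (false, Or A _)) Yin); rewrite -msetDA msetDCA => /IH.
by rewrite [in X in _ -> X]mset_cons -msetDA msetDCA.
Qed.

(** * Translation between marked sequents and the signed calculus *)

Definition tag (G D : {mset formula}) : world :=
  mmap (pair true) G `+` mmap (pair false) D.

Lemma tag_consl A G D : tag (A +` G) D = (true, A) +` tag G D.
Proof. by rewrite /tag mmap_cons msetDA. Qed.

Lemma tag_consr A G D : tag G (A +` D) = (false, A) +` tag G D.
Proof. by rewrite /tag mmap_cons msetDCA. Qed.

Lemma tagD G1 D1 G2 D2 : tag (G1 `+` G2) (D1 `+` D2) = tag G1 D1 `+` tag G2 D2.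
Proof. by rewrite /tag !mmapD msetDACA. Qed.

Lemma tagE G D b A : (tag G D) (b, A) = if b then G A else D A.
Proof.
have tagged_count c (X : {mset formula}) :
    (mmap (pair c) X) (b, A) = if b == c then X A else 0.
  elim/mset_ind: X => [|B X IH]; first by rewrite mmap0 !mset0E; case: (b == c).
  by rewrite mmap_cons !msetDE IH !msetnE xpair_eqE; case: (b == c).
by rewrite /tag msetDE !tagged_count; case: (b); rewrite ?addn0.
Qed.

(** With [tag_surj], this makes signed multisets the same as pairs of antecedent and succedent, so
    rules can be read back from the signed calculus. *)
Lemma tag_inj G1 D1 G2 D2 : tag G1 D1 = tag G2 D2 -> G1 = G2 /\ D1 = D2.
Proof.
by move/msetP=> E; split; apply/msetP => A;
  [move: (E (true, A)) | move: (E (false, A))]; rewrite !tagE.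
Qed.

Lemma tag_surj (X : world) : exists G D, X = tag G D.
Proof.
elim/mset_ind: X => [|[b A] X [G [D ->]]].
  by exists mset0, mset0; rewrite /tag !mmap0 msetD0.
by case: b; [exists (A +` G), D | exists G, (A +` D)]; rewrite (tag_consl, tag_consr).
Qed.

Lemma tag_eq0 G D : (tag G D == mset0) = (G == mset0) && (D == mset0).
Proof. by rewrite msetD_eq0 !mmap_eq0. Qed.

Lemma all_tag (p : pred formula) G D :
  all (fun s : sformula => p s.2) (tag G D) = all p G && all p D.
Proof. by rewrite all_msetD !all_mmap. Qed.

Definition erase (b : mark * {mset formula} * {mset formula}) : world := tag b.1.2 b.2.

Lemma proper_erase b : proper_world (erase b) = proper_block b.
Proof.
case: b => [[k P] Q]; rewrite /proper_world tag_eq0 negb_and.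
by rewrite (all_tag atomic).
Qed.

Lemma all_proper_erase (m : {mset mark * {mset formula} * {mset formula}}) :
  all proper_world (mmap erase m) = proper m.
Proof. by rewrite all_mmap; apply: eq_all => b; apply: proper_erase. Qed.

Lemma erase_add_block k P Q m :
  mmap erase (add_block k P Q m) = add_world (tag P Q) (mmap erase m).
Proof.
by rewrite /add_block /add_world tag_eq0; case: ifP => _; rewrite ?mmap_cons.
Qed.

Lemma prv_of_provable s :
  provable s -> prv (tag (ant s) (suc s)) (mmap erase (mid s)).
Proof.
elim=> {s} /=.
- move=> p G m D ap pm; rewrite tag_consl tag_consr.
  by apply: prv_ax; rewrite ?all_proper_erase.
- by move=> G m D pm; rewrite tag_consl; apply: prv_bot; rewrite ?all_proper_erase.
- move=> A G m D _; rewrite tag_consl tag_consr => d.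
  by apply: prv_prop => // Y; rewrite inE => /eqP->.
- move=> A G m D _; rewrite tag_consl tag_consr => d.
  by apply: prv_prop => // Y; rewrite inE => /eqP->.
- move=> A B G m D _ + _; rewrite !tag_consl => d1 d2.
  by apply: prv_prop => // Y; rewrite !inE => /orP[]/eqP->.
- move=> A B G m D _; rewrite !tag_consr => d.
  by apply: prv_prop => // Y; rewrite !inE => /eqP->; rewrite -msetDA.
- move=> A B G m D _; rewrite !tag_consl => d.
  by apply: prv_prop => // Y; rewrite !inE => /eqP->; rewrite -msetDA.
- move=> A B G m D _ + _; rewrite !tag_consr => d1 d2.
  by apply: prv_prop => // Y; rewrite !inE => /orP[]/eqP->.
- move=> A B G m D _ + _; rewrite tag_consl tag_consr tag_consl => d1 d2.
  by apply: prv_prop => // Y; rewrite !inE => /orP[]/eqP->.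
- move=> A B G m D _; rewrite tag_consl !tag_consr => d.
  by apply: prv_prop => // Y; rewrite !inE => /eqP->; rewrite -msetDA.
- move=> A G m D _; rewrite !tag_consr msetDCA => d.
  exact: prv_refl.
- move=> A G m D _; rewrite !tag_consl => d.
  exact: prv_refl.
- move=> A M N P Q m mM mN aP aQ _; rewrite !tag_consl erase_add_block => d.
  rewrite [Q `+` N]msetDC tagD; apply: prv_new => //.
    by rewrite (all_tag modal) mM.
  by rewrite (all_tag atomic) aP.
- move=> A M N P Q m mM mN aP aQ _; rewrite !tag_consr erase_add_block => d.
  rewrite [Q `+` N]msetDC tagD; apply: prv_new => //.
    by rewrite (all_tag modal) mM.
  by rewrite (all_tag atomic) aP.
- move=> M N P Q P2 Q2 m mM mN aP aQ pb _; rewrite erase_add_block.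
  rewrite [Q2 `+` N]msetDC [Q `+` N]msetDC !tagD mmap_cons => d.
  apply: prv_jump => //; last by rewrite proper_erase.
    by rewrite (all_tag modal) mM.
  by rewrite (all_tag atomic) aP.
- move=> M N P Q P2 Q2 m mM mN aP aQ pb _; rewrite erase_add_block.
  rewrite [Q2 `+` N]msetDC [Q `+` N]msetDC !tagD mmap_cons => d.
  apply: prv_jump => //; last by rewrite proper_erase.
    by rewrite (all_tag modal) mM.
  by rewrite (all_tag atomic) aP.
Qed.

(** The claim is made for every marking [m] of the blocks, so that in the induction the mark of a
    newly stored block can be chosen as the rule demands. *)
Lemma provable_of_prv (X : world) (m0 : worlds) : prv X m0 ->
  forall G m D, X = tag G D -> m0 = mmap erase m -> provable (Seq G m D).
Proof.
elim=> {X m0}.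
- move=> p X m0 ap + G m D; have [G' [D' ->]] := tag_surj X.
  rewrite -tag_consr -tag_consl => + /tag_inj[<- <-] Em.
  by rewrite Em all_proper_erase; apply: ax_atom.
- move=> X m0 + G m D; have [G' [D' ->]] := tag_surj X.
  rewrite -tag_consl => + /tag_inj[<- <-] Em.
  by rewrite Em all_proper_erase; apply: ax_bot.
- move=> s X m0 cs _ + G m D; have [G' [D' ->]] := tag_surj X.
  case: s cs => -[] [] //=.
  + move=> A _ IH; rewrite -tag_consl => /tag_inj[<- <-] Em; apply: L_neg.
    by apply: IH => //; rewrite ?inE // tag_consr.
  + move=> A B _ IH; rewrite -tag_consl => /tag_inj[<- <-] Em; apply: L_and.
    by apply: IH => //; rewrite ?inE // !tag_consl msetDA.
  + move=> A B _ IH; rewrite -tag_consl => /tag_inj[<- <-] Em; apply: L_or.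
      by apply: (IH [mset (true, A)]); rewrite ?inE ?eqxx ?tag_consl.
    by apply: (IH [mset (true, B)]); rewrite ?inE ?eqxx ?orbT ?tag_consl.
  + move=> A B _ IH; rewrite -tag_consl => /tag_inj[<- <-] Em; apply: L_imp.
      by apply: (IH [mset (false, A)]); rewrite ?inE ?eqxx ?tag_consr.
    by apply: (IH [mset (true, B)]); rewrite ?inE ?eqxx ?orbT ?tag_consl.
  + move=> A _ IH; rewrite -tag_consr => /tag_inj[<- <-] Em; apply: R_neg.
    by apply: IH => //; rewrite ?inE // tag_consl.
  + move=> A B _ IH; rewrite -tag_consr => /tag_inj[<- <-] Em; apply: R_and.
      by apply: (IH [mset (false, A)]); rewrite ?inE ?eqxx ?tag_consr.
    by apply: (IH [mset (false, B)]); rewrite ?inE ?eqxx ?orbT ?tag_consr.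
  + move=> A B _ IH; rewrite -tag_consr => /tag_inj[<- <-] Em; apply: R_or.
    by apply: IH => //; rewrite ?inE // !tag_consr msetDA.
  + move=> A B _ IH; rewrite -tag_consr => /tag_inj[<- <-] Em; apply: R_imp.
    by apply: IH => //; rewrite ?inE // tag_consl tag_consr msetDA.
- move=> s X m0 ns _ + G m D; have [G' [D' ->]] := tag_surj X.
  case: s ns => -[] [] // A _ IH; rewrite -?tag_consl -?tag_consr => /tag_inj[<- <-] Em.
    by apply: L_box; apply: IH => //; rewrite !tag_consl.
  by apply: R_dia; apply: IH => //; rewrite !tag_consr msetDCA.
- move=> s M W m0 ps + + _ + G m D.
  have [M' [N ->]] := tag_surj M; have [P [Q ->]] := tag_surj W.
  rewrite (all_tag modal) (all_tag atomic) => /andP[mM mN] /andP[aP aQ].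
  rewrite -tagD [N `+` Q]msetDC.
  case: s ps => -[] [] // A _ IH; rewrite -?tag_consl -?tag_consr => /tag_inj[<- <-] Em.
    by apply: L_dia => //; apply: IH; rewrite ?erase_add_block ?Em // tag_consl.
  by apply: R_box => //; apply: IH; rewrite ?erase_add_block ?Em // tag_consr.
- move=> M W V m0 + + + _ + G m D.
  have [M' [N ->]] := tag_surj M; have [P [Q ->]] := tag_surj W.
  rewrite (all_tag modal) (all_tag atomic) => /andP[mM mN] /andP[aP aQ] pV.
  rewrite -tagD [N `+` Q]msetDC => IH /tag_inj[<- <-] /esym/mmap_consE.
  case=> -[[k P2] Q2] [m' [-> EV Em]].
  move: pV; rewrite EV proper_erase => pb.
  (* The premise is available with either mark on the new block; the mark [k] of the opened block
     then selects the rule. *)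
  have {}IH k' : provable (Seq (M' `+` P2) (add_block k' P Q m') (Q2 `+` N)).
    by apply: IH; rewrite ?erase_add_block ?Em // EV -tagD [N `+` _]msetDC.
  by case: k pb {EV} => pb; [apply: L_dia_semi | apply: R_box_semi].
Qed.

(** * Block formulas and admissibility of the general rules *)

(** The inversion property that [prv_general] asks of a diamond block: inverting the conjunction and
    then the negations, which carry [D] to the succedent. *)
Lemma dia_block_refine (G D : {mset formula}) (X : world) (m : worlds) :
  (G != mset0) || (D != mset0) ->
  prv ((true, conj_mset (G `+` negs D)) +` X) m -> prv (tag G D `+` X) m.
Proof.
move=> GD0 /prv_conj; rewrite msetD_eq0 mmap_eq0 negb_and => /(_ GD0).
rewrite mmapD -msetDA msetDCA => /prv_negs.
by rewrite msetDCA msetDA.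
Qed.

Lemma box_block_refine (G D : {mset formula}) (X : world) (m : worlds) :
  (G != mset0) || (D != mset0) ->
  prv ((false, disj_mset (negs G `+` D)) +` X) m -> prv (tag G D `+` X) m.
Proof.
move=> GD0 /prv_disj; rewrite msetD_eq0 mmap_eq0 negb_and => /(_ GD0).
by rewrite mmapD -msetDA => /prv_negs; rewrite msetDA.
Qed.

Lemma nonatomic_neq0 (G D : {mset formula}) :
  ~~ (all atomic G && all atomic D) -> (G != mset0) || (D != mset0).
Proof.
apply: contraR; rewrite negb_or !negbK => /andP[/eqP-> /eqP->].
by rewrite all_mset0.
Qed.

Theorem lemma4p13 : admissible RBoxG /\ admissible LDiaG.
Proof.
split=> prems concl [A M N G D m mM mN pm] /(_ 0 isT) /=.
(* An atomic block makes this an instance of the original rule; otherwise the premise carries the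
   block formula in its outer part. *)
- rewrite /with_block; case: ifP => [/andP[aG aD]|/negbT/nonatomic_neq0 GD0].
    exact: R_box.
  move=> /prv_of_provable /=; rewrite tag_consl tag_consr => d.
  apply: (provable_of_prv _ erefl erefl).
  rewrite tag_consr [D `+` N]msetDC tagD.
  (* The possibility [s0], read off from [d], is the diamond block formula in the antecedent. *)
  apply: (prv_general (s := (false, Box A)) (G := tag G D) _ _ _ _ d) => //.
    by rewrite (all_tag modal) mM.
  by move=> Y m'; apply: dia_block_refine.
- rewrite /with_block; case: ifP => [/andP[aG aD]|/negbT/nonatomic_neq0 GD0].
    exact: L_dia.
  move=> /prv_of_provable /=; rewrite tag_consr tag_consl => d.
  apply: (provable_of_prv _ erefl erefl).
  rewrite tag_consl [D `+` N]msetDC tagD.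
  (* Now [s0] is the box block formula, a possibility because it stands in the succedent. *)
  apply: (prv_general (s := (true, Dia A)) (G := tag G D) _ _ _ _ d) => //.
    by rewrite (all_tag modal) mM.
  by move=> Y m'; apply: box_block_refine.
Qed.
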